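(* Let $K$ be any real number field (a subfield of $\mathbb{R}$ of finite degree over $\mathbb{Q}$) and let $m$ be any positive integer. There exists an extension field $F$ of $K$ such that $[F:K]=m$. When $m$ is odd, the extension may be chosen to be real, i.e. with $F\subset\mathbb{R}$. *)

(* Defs.v *)
From HB Require Import structures.
From mathcomp Require Import all_boot all_order all_algebra all_field.
From mathcomp Require Import reals.

Set Implicit Arguments.
Unset Strict Implicit.
Unset Printing Implicit Defensive.

Import GRing.Theory Num.Theory.
Local Open Scope ring_scope.

(* A subfield of E is a subset K : divringClosed E, i.e. one that contains 1
   and is closed under subtraction and division; subfield_type K is the same
   field as a type, and val is the inclusion into E. *)
Definition subfield_type (E : fieldType) (K : divringClosed E) : Type :=
  {x : E | x \in K}.

Section SubfieldType.
Variables (E : fieldType) (K : divringClosed E).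
HB.instance Definition _ := SubChoice.copy (subfield_type K) {x : E | x \in K}.
HB.instance Definition _ :=
  [SubChoice_isSubIntegralDomain of (subfield_type K) by <:].
HB.instance Definition _ :=
  [SubIntegralDomain_isSubField of (subfield_type K) by <:].
End SubfieldType.

(* The subset F of E contains the image of k under i, is a field, and
   [F : k] = n. The degree is the dimension of a fieldExtType over k that f
   identifies with F compatibly with i. *)
Definition is_extension_of_degree (k E : fieldType) (i : {rmorphism k -> E})
    (F : {pred E}) (n : nat) : Prop :=
  exists (L : fieldExtType k) (f : {rmorphism L -> E}),
    [/\ forall a : k, f a%:A = i a,
        forall x : E, x \in F <-> exists y : L, f y = x
      & \dim {:L} = n].

Definition is_real_number_field (R : realType) (K : divringClosed R) : Prop :=
  exists d : nat,
    is_extension_of_degree (ratr : {rmorphism rat -> R}) K d.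

(* Main.v *)
(** Let N be the largest integer such that the positive N-th root b of 2 lies in
    K; it exists because X^N - 2 is irreducible over Q, so N <= [K : Q].  Let x
    be the positive m-th root of b.  Every complex root of X^m - b has absolute
    value x, so a factor of degree d > 0 over K has constant term ± x^d.  Hence
    x^d, and then x^gcd(d, m), lies in K; being a positive root of 2 of order
    N m / gcd(d, m), it forces gcd(d, m) = m by maximality of N.  So X^m - b is
    irreducible and K(x) is a real extension of degree m, whatever the parity
    of m. *)

Require Import Defs.
From HB Require Import structures.
From mathcomp Require Import all_boot all_order all_algebra all_field.
From mathcomp Require Import boolp reals.

Set Implicit Arguments.
Unset Strict Implicit.
Unset Printing Implicit Defensive.

Import Order.TTheory GRing.Theory Num.Theory.
Local Open Scope ring_scope.

(* The product of the roots of p is read off the companion matrix C of p: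
   C ^+ m = a%:M, and p`_0 is the determinant of C up to sign. *)
Lemma dvdp_Xn_sub_coef0 (k : fieldType) (p : {poly k}) (a : k) (m : nat) :
  p \is monic -> p %| 'X^m - a%:P ->
  ((-1) ^+ (size p).-1 * p`_0) ^+ m = a ^+ (size p).-1.
Proof.
move=> p_mon p_dvd; have [d_eq0 | d_gt0] := posnP (size p).-1.
  have /monicP := p_mon; rewrite d_eq0 /lead_coef d_eq0 => ->.
  by rewrite !expr0 mulr1 expr1n.
have := companionmxK p_mon.
move: (companionmx p); case: _.-1 d_gt0 => // d _ C Cp.
have Cm : C ^+ m = a%:M.
  have /dvdpP[q Dq] := p_dvd; apply/eqP; rewrite -subr_eq0; apply/eqP.
  rewrite -(horner_mx_X C) -rmorphXn -(horner_mx_C C a) -rmorphB Dq rmorphM /=.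
  by rewrite -Cp Cayley_Hamilton mulr0.
have -> : (-1) ^+ d.+1 * p`_0 = \det C.
  by rewrite -Cp char_poly_det mulrA -exprMn mulrNN mul1r expr1n mul1r.
have detX n : \det (C ^+ n) = \det C ^+ n.
  by elim: n => [|n IHn]; rewrite ?expr0 ?det1 // !exprS detM IHn.
by rewrite -detX Cm det_scalar.
Qed.

(** Bezout gives u d = v m + gcd(d, m), so the quotient of (x^d)^u by (x^m)^v is the required
    power. *)
Lemma gcd_power_in_subfield (k E : fieldType) (i : {rmorphism k -> E}) (x : E)
    (m d : nat) :
  x != 0 -> (0 < d)%N -> (exists a, i a = x ^+ m) -> (exists b, i b = x ^+ d) ->
  exists c, i c = x ^+ gcdn d m.
Proof.
move=> x_neq0 d_gt0 [a Da] [b Db]; have [u v Duv _] := egcdnP m d_gt0.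
exists (b ^+ u / a ^+ v).
rewrite fmorph_div !rmorphXn Da Db -!exprM mulnC Duv exprD mulnC.
by rewrite mulrAC divff ?mul1r // expf_neq0.
Qed.

Lemma irreducible_Xn_sub (R : realFieldType) (k : fieldType)
    (i : {rmorphism k -> R}) (x : R) (a : k) (m : nat) :
  (0 < m)%N -> 0 < x -> i a = x ^+ m ->
  (forall e b, (0 < e < m)%N -> (e %| m)%N -> i b != x ^+ e) ->
  irreducible_poly ('X^m - a%:P).
Proof.
move=> m_gt0 x_gt0 Da x_min; have szP := size_XnsubC a m_gt0.
split=> [|q szq q_dvd]; first by rewrite szP.
have P_neq0 : 'X^m - a%:P != 0 by rewrite -size_poly_gt0 szP.
have q_neq0 : q != 0 by apply: contraNneq P_neq0 => q0; rewrite -dvd0p -q0.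
pose p := (lead_coef q)^-1 *: q.
have p_mon : p \is monic by rewrite monicE lead_coefZ mulVf ?lead_coef_eq0.
have szp : size p = size q by rewrite size_scale // invr_eq0 lead_coef_eq0.
have p_dvd : p %| 'X^m - a%:P by rewrite dvdpZl // invr_eq0 lead_coef_eq0.
have := dvdp_Xn_sub_coef0 p_mon p_dvd; rewrite szp.
set d := (size q).-1; set c := _ * _ => Dc.
have d_gt0 : (0 < d)%N.
  rewrite /d -ltnS prednK ?size_poly_gt0 // ltn_neqAle eq_sym szq.
  by rewrite size_poly_gt0.
have [b Db] : exists b, i b = x ^+ d.
  (* Since c^m = a^d and [i a] = x^m, both sides are nonnegative with the same m-th power. The sign
     lost here is absorbed by taking [c] or [- c]. *)
  have: `|i c| = x ^+ d.
    apply/eqP; rewrite -(eqrXn2 m_gt0) ?normr_ge0 ?exprn_ge0 ?(ltW x_gt0) //.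
    rewrite -normrX -rmorphXn Dc rmorphXn Da exprAC ger0_norm //.
    by rewrite !exprn_ge0 // ltW.
  by case: (ger0P (i c)) => _ <-; [exists c | exists (- c); rewrite rmorphN].
have [g Dg] := gcd_power_in_subfield (lt0r_neq0 x_gt0) d_gt0
  (ex_intro _ a Da) (ex_intro _ b Db).
have m_le_g : (m <= gcdn d m)%N.
  rewrite leqNgt; apply/negP => g_lt.
  have g_int : (0 < gcdn d m < m)%N by rewrite gcdn_gt0 d_gt0.
  by have := x_min _ g g_int (dvdn_gcdr d m); rewrite Dg eqxx.
(* From m <= gcd(d, m) <= d, the divisor [q] has full degree. *)
rewrite -dvdp_size_eqp // szP eqn_leq -szP dvdp_leq //= szP.
rewrite (leq_ltn_trans m_le_g) // -[size q]prednK ?size_poly_gt0 // ltnS.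
by rewrite dvdn_leq // dvdn_gcdl.
Qed.

Lemma root_map_Xn_sub (k E : fieldType) (i : {rmorphism k -> E}) (a : k)
    (x : E) (n : nat) :
  x ^+ n = i a -> root (map_poly i ('X^n - a%:P)) x.
Proof.
by move=> Dx; rewrite rmorphB /= map_polyXn map_polyC rootE !hornerE Dx subrr.
Qed.

Lemma exists_nth_root (R : rcfType) (c : R) (n : nat) :
  (0 < n)%N -> 0 < c -> exists2 x : R, 0 < x & x ^+ n = c.
Proof.
move=> n_gt0 c_gt0; have c1_ge0 : 0 <= c + 1 by rewrite addr_ge0 ?ler01 // ltW.
(* The endpoint c + 1 is at least 1, so (c + 1)^n >= c + 1 >= c even when c < 1. *)
have [|x x_int] := @poly_ivt R ('X^n - c%:P) 0 (c + 1) c1_ge0.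
  rewrite !hornerE expr0n eqn0Ngt n_gt0 sub0r oppr_le0 ltW //= subr_ge0.
  by rewrite (le_trans _ (ler_eXnr n_gt0 _)) ?lerDl ?ler01 ?lerDr ?ltW.
rewrite rootE !hornerE subr_eq0 => /eqP Dx; exists x => //.
have /andP[x_ge0 _] := x_int; rewrite lt0r x_ge0 andbT.
apply: contraTneq c_gt0 => x0.
by rewrite -Dx x0 expr0n eqn0Ngt n_gt0 ltxx.
Qed.

(** Eisenstein's criterion at 2 over the integers, carried to the rationals. *)
Lemma irreducible_Xn_sub2 (n : nat) :
  (0 < n)%N -> irreducible_poly ('X^n - 2%:P : {poly rat}).
Proof.
move=> n_gt0; have sz := size_XnsubC (2 : int) n_gt0.
have -> : 'X^n - 2%:P = map_poly intr ('X^n - 2%:P) :> {poly rat}.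
  by rewrite rmorphB /= map_polyXn map_polyC.
apply/irreducible_rat_int/(@eisenstein_crit 2) => //.
- by rewrite sz eqSS -lt0n.
- by rewrite (monicP (monicXnsubC _ n_gt0)).
- by rewrite coefB coefXn coefC eq_sym eqn0Ngt n_gt0.
move=> i; rewrite sz /= => lt_in; rewrite coefB coefXn coefC (ltn_eqF lt_in).
by case: eqP.
Qed.

(** The minimal polynomial of [x] over the rationals has degree at most d, while the irreducible X^n
    - 2 has least degree among nonzero polynomials vanishing at [x]. *)
Lemma root2_degree_bound (R : realType) (K : divringClosed R) (d n : nat)
    (x : R) :
  is_extension_of_degree (ratr : {rmorphism rat -> R}) K d ->
  (0 < n)%N -> x ^+ n = 2 -> x \in K -> (n <= d)%N.
Proof.
move=> [L [f [fE KE dimL]]] n_gt0 Dx /KE[y Dy].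
have /polyOver1P[p Dp] := minPolyOver 1%AS y.
have p_neq0 : p != 0.
  by rewrite -(map_poly_eq0 (in_alg L)) -Dp monic_neq0 // monic_minPoly.
have szp : (size p <= d.+1)%N.
  rewrite -(size_map_poly (in_alg L)) -Dp size_minPoly ltnS adjoin_degreeE.
  by rewrite dimv1 divn1 -dimL dimvS // subvf.
have px0 : root (map_poly ratr p) x.
  have -> : map_poly ratr p = map_poly f (minPoly 1 y) :> {poly R}.
    by rewrite Dp -map_poly_comp; apply: eq_map_poly => a /=; rewrite fE.
  by rewrite -Dy fmorph_root root_minPoly.
have Px0 : root (map_poly (ratr : {rmorphism rat -> R}) ('X^n - 2%:P)) x.
  by apply: root_map_Xn_sub; rewrite /= ratr_nat.
have irrP := irreducible_Xn_sub2 n_gt0.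
have /= minP := (subfx_irreducibleP Px0 (irredp_neq0 irrP)).2 irrP.
by have := leq_trans (minP _ px0 p_neq0) szp; rewrite size_XnsubC.
Qed.

Section RmorphismImage.
Variables (L E : fieldType) (f : {rmorphism L -> E}).

(** Classical reflection makes the image a boolean predicate, as [divringClosed] requires. *)
Definition rmorphism_image : {pred E} := fun x => `[< exists y, f y = x >].

Lemma rmorphism_imageP x : reflect (exists y, f y = x) (x \in rmorphism_image).
Proof. exact: asboolP. Qed.

Fact rmorphism_image_divring_closed : divring_closed rmorphism_image.
Proof.
split.
- by apply/rmorphism_imageP; exists 1; rewrite rmorph1.
- move=> _ _ /rmorphism_imageP[a <-] /rmorphism_imageP[b <-].
  by apply/rmorphism_imageP; exists (a - b); rewrite rmorphB.
- move=> _ _ /rmorphism_imageP[a <-] /rmorphism_imageP[b <-].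
  by apply/rmorphism_imageP; exists (a / b); rewrite fmorph_div.
Qed.

HB.instance Definition _ :=
  GRing.isDivringClosed.Build E rmorphism_image rmorphism_image_divring_closed.

Definition image_subfield : divringClosed E := rmorphism_image.
End RmorphismImage.

(** The extension is k[X]/(p), embedded in [E] by sending the class of X to [x]. *)
Lemma exists_extension_of_root (k E : fieldType) (i : {rmorphism k -> E})
    (p : {poly k}) (x : E) :
  irreducible_poly p -> root (map_poly i p) x ->
  exists (L : fieldExtType k) (f : {rmorphism L -> E}),
    (forall a : k, f a%:A = i a) /\ \dim {:L} = (size p).-1.
Proof.
move=> irr_p px0; pose L := SubFieldExtType px0 irr_p.
exists L, (@subfx_inj _ _ i x p : {rmorphism _ -> _}); split.
  by move=> a; rewrite /= subfx_inj_base // irredp_neq0.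
by rewrite dimvf.
Qed.

Lemma exists_irreducible_Xn_sub (R : realType) (K : divringClosed R) (m : nat) :
  is_real_number_field K -> (0 < m)%N ->
  exists (a : subfield_type K) (x : R),
    irreducible_poly ('X^m - a%:P) /\ x ^+ m = val a.
Proof.
move=> [d hK] m_gt0.
pose P n := (0 < n)%N && `[< exists x : R, [/\ 0 < x, x ^+ n = 2 & x \in K] >].
have exP : exists n, P n.
  exists 1%N; apply/asboolP; exists 2; split; rewrite ?expr1 ?ltr0n //.
  exact: rpred_nat.
have P_le n : P n -> (n <= d)%N.
  move=> /andP[n_gt0 /asboolP[x [_ Dx Kx]]].
  exact: root2_degree_bound hK n_gt0 Dx Kx.
case: (ex_maxnP exP P_le) => N /andP[N_gt0 /asboolP[b [b_gt0 Db Kb]]] maxN.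
have [x x_gt0 Dx] := exists_nth_root m_gt0 b_gt0.
exists (Sub b Kb), x; split; last by rewrite SubK.
apply: (@irreducible_Xn_sub _ _ (val : {rmorphism _ -> R}) x) => //.
(* With m = q e and q > 1, the element x^e of [K] satisfies (x^e)^(q N) = b^N = 2, against the
   maximality of [N]. *)
move=> e c /andP[e_gt0 lt_em] /dvdnP[q Dm]; apply/eqP => Dc.
have q_gt1 : (1 < q)%N by rewrite -(ltn_pmul2r e_gt0) mul1n -Dm.
have /maxN : P (q * N)%N.
  rewrite /P muln_gt0 N_gt0 ltnW //=; apply/asboolP; exists (x ^+ e); split.
  - exact: exprn_gt0.
  - by rewrite -exprM mulnA (mulnC e) -Dm exprM Dx.
  - by rewrite -Dc; apply: valP.
by rewrite -{2}[N]mul1n leq_pmul2r // leqNgt q_gt1.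
Qed.

Theorem mainTheorem8 (R : realType) (K : divringClosed R)
    (hK : is_real_number_field K) (m : nat) (hm : (0 < m)%N) :
  (exists F : fieldExtType (subfield_type K), \dim {:F} = m) /\
  (odd m ->
   exists F : divringClosed R,
     {subset K <= F} /\
     is_extension_of_degree
       (val : {rmorphism subfield_type K -> R}) F m).
Proof.
have [a [x [irr_p Dx]]] := exists_irreducible_Xn_sub hK hm.
have px0 : root (map_poly (val : {rmorphism subfield_type K -> R})
                          ('X^m - a%:P)) x.
  exact: root_map_Xn_sub.
(* [L] itself answers the first claim, and its image under [f] is the real field of the second. *)
have [L [f [fE]]] := exists_extension_of_root irr_p px0.
rewrite size_XnsubC //= => dimL; split; first by exists L.
move=> _; exists (image_subfield f); split.
  move=> y Ky; apply/rmorphism_imageP; exists (Sub y Ky)%:A.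
  by rewrite fE.
exists L, f; split=> // y; split=> [/rmorphism_imageP //|].
by move=> ?; apply/rmorphism_imageP.
Qed.
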